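(* For a tree $T$ of order $n$, $SEC(T)=n-1$ if and only if $T\cong S_4$ or $T\cong P_5$.
   Context: Graphs are finite and simple with a non-empty vertex set; $n=|V(T)|$ is the order of $T$. $S_n$ denotes the star on $n$ vertices (so $S_4\cong K_{1,3}$) and $P_n$ the path on $n$ vertices. A set $D\subseteq V(G)$ is a dominating set of a graph $G$ if every vertex of $V(G)\setminus D$ is adjacent to at least one vertex of $D$. A secure dominating set $S$ of $G$ is a dominating set such that each vertex $u\in V(G)\setminus S$ is adjacent to some vertex $v\in S$ for which $(S\setminus\{v\})\cup\{u\}$ is a dominating set. Two disjoint vertex sets $V_1,V_2\subseteq V(G)$ form a secure coalition if neither $V_1$ nor $V_2$ is a secure dominating set but $V_1\cup V_2$ is a secure dominating set. A secure coalition partition ($sec$-partition) of a graph $G$ of order $n$ is a partition $\pi=\{V_1,\dots,V_k\}$ of $V(G)$ (into non-empty sets) such that every $V_i$ either is a secure dominating set consisting of a single vertex of degree $n-1$, or is not a secure dominating set but forms a secure coalition with another set $V_j\in\pi$. The secure coalition number $SEC(G)$ is the maximum cardinality of a secure coalition partition of $G$ (every graph has at least one such partition). *)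

(* Defs.v *)
From mathcomp Require Import all_boot.

Set Implicit Arguments.
Unset Strict Implicit.
Unset Printing Implicit Defensive.

(* A graph on the finite vertex type [V] is given by its adjacency relation. *)

Section Graphs.

Variables (V : finType) (e : rel V).

Definition simple_graph : Prop := symmetric e /\ irreflexive e.

Definition connected_graph : Prop := forall x y : V, connect e x y.

(* [ucycle e c] also holds for [::] and, when [e] is symmetric, for the
   back-and-forth walk [:: x; y]; genuine cycles have at least 3 vertices. *)
Definition acyclic_graph : Prop := forall c : seq V, ucycle e c -> size c < 3.

Definition tree : Prop :=
  [/\ 0 < #|V|, simple_graph, connected_graph & acyclic_graph].

Definition degree (v : V) : nat := #|[set w | e v w]|.

Definition dominating (D : {set V}) : bool :=
  [forall u in ~: D, [exists v in D, e u v]].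

Definition secure_dominating (S : {set V}) : bool :=
  dominating S &&
  [forall u in ~: S, [exists v in S, e u v && dominating (u |: S :\ v)]].

Definition secure_coalition (A B : {set V}) : bool :=
  [&& [disjoint A & B], ~~ secure_dominating A, ~~ secure_dominating B
    & secure_dominating (A :|: B)].

(* [partition] already requires the blocks to be non-empty. *)
Definition sec_partition (P : {set {set V}}) : bool :=
  partition P [set: V] &&
  [forall A in P,
     (secure_dominating A &&
        [exists v, (A == [set v]) && (degree v == #|V| - 1)])
  || (~~ secure_dominating A &&
        [exists B in P, (B != A) && secure_coalition A B])].

(* The empty maximum is 0, but every graph has a sec-partition. *)
Definition SEC : nat := \max_(P : {set {set V}} | sec_partition P) #|P|.

End Graphs.

Definition graph_iso (V W : finType) (e : rel V) (f : rel W) : Prop :=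
  exists2 h : V -> W, bijective h & forall x y, f (h x) (h y) = e x y.

(* The star on [n] vertices, centred at the vertex of value 0. *)
Definition star_graph (n : nat) : rel 'I_n :=
  fun i j => (i != j) && ((val i == 0) || (val j == 0)).

Definition path_graph (n : nat) : rel 'I_n :=
  fun i j => (i.+1 == j) || (j.+1 == i).
Arguments star_graph n : clear implicits.
Arguments path_graph n : clear implicits.

(* Main.v *)
Require Import Defs.
From mathcomp Require Import all_boot.

Set Implicit Arguments.
Unset Strict Implicit.
Unset Printing Implicit Defensive.

(** The proof rests on two counts.

    Blocks of a partition are non-empty, so in a partition into k sets two
    blocks together have at most n - k + 2 elements ([leq_two_blocks]): when k
    is close to n, every secure dominating set produced by a coalition is tiny.
    On the other hand a secure dominating set of a tree cannot be tiny.  A tree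
    has no triangle, so if v in S defends u outside S, every other vertex w
    outside S keeps a neighbour in S distinct from v ([defenderP]).  If S has at
    most two elements and v defends both u and u', then u and u' are both
    adjacent to v and to the other element of S, a 4-cycle; so defenders are
    distinct and n <= 2 #|S| ([secure_order_bound]).

    Let SEC(T) = n - 1 with n >= 5.  By the two counts a partition with n - 1
    sets consists of a pair {x, y} and of singletons, and every singleton {s}
    is in coalition with the pair, that is, {x, y, s} is secure dominating for
    every other vertex s ([pair_block_of_SEC]).  Since this holds for all s at once, T is
    extremely constrained: the position of {x, y} (not dominating; dominating
    with a common neighbour; dominating without one) leaves in each case only
    one possible shape, since any further vertex closes a cycle of length 3, 4
    or 6 or is a second private neighbour of x or y.  The shape is a path on
    five vertices each time, with x and y at distance 4, 2 and 3 respectively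
    ([spanning_path_pair_block]); and a spanning path of a tree has no chord,
    so T is P_5.

    For n <= 4 the trees are the complete graphs on one and two vertices, P_3,
    P_4 and S_4.  In all of them but S_4 the partition into singletons is a
    secure coalition partition, which gives SEC(T) = n.

    Conversely, P_5 and S_4 have no secure dominating set of size at most 2, so
    SEC < n, and one suitable pair together with singletons gives n - 1.  The
    domination facts about these concrete graphs are decided by computation on
    vertex labels. *)

(** * Partitions into small blocks *)

Section Partitions.

Variables (V : finType) (e : rel V).

Lemma leq_SEC (P : {set {set V}}) : sec_partition e P -> #|P| <= SEC e.
Proof. by move=> secP; rewrite /SEC (bigD1 P) //= leq_maxl. Qed.

Lemma SEC_attained : 0 < SEC e ->
  exists2 P : {set {set V}}, sec_partition e P & #|P| = SEC e.
Proof.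
rewrite /SEC => SEC_gt0; have [P /= secP | noP] := pickP (sec_partition e).
  have: 0 < #|[pred P | sec_partition e P]| by apply/card_gt0P; exists P.
  case/(eq_bigmax_cond (fun P : {set {set V}} => #|P|)) => Q secQ Qmax.
  by exists Q => //; symmetry.
by rewrite big_pred0 in SEC_gt0.
Qed.

(** Every block other than [A] and [B] uses at least one vertex. *)
Lemma leq_two_blocks (P : {set {set V}}) (A B : {set V}) :
  partition P [set: V] -> A \in P -> B \in P -> A != B ->
  #|A| + #|B| + #|P| <= #|V| + 2.
Proof.
move=> partP AP BP neAB; rewrite -cardsT (card_partition partP).
rewrite (cardsD1 A) AP (cardsD1 B) !inE eq_sym neAB BP /=.
rewrite (bigD1 A) //= (bigD1 B) /=; last by rewrite BP eq_sym.
suff: #|P :\ A :\ B| <= \sum_(C | (C \in P) && (C != A) && (C != B)) #|C|.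
  by rewrite (addnA #|A|) -[_ + 2]addnA leq_add2l !add1n addn2 !ltnS.
rewrite -sum1_card [leqLHS](eq_bigl (fun C => (C \in P) && (C != A) && (C != B))).
  apply: leq_sum => C /andP[/andP[CP _] _]; rewrite card_gt0.
  by apply: contraTneq CP => ->; case/and3P: partP.
by move=> C; rewrite !inE; case: (C \in P); rewrite ?andbF ?andbT //= andbC.
Qed.

Lemma leq_card_sec_partition (P : {set {set V}}) :
  sec_partition e P -> #|P| <= #|V|.
Proof.
case/andP=> partP _; rewrite -cardsT (card_partition partP) -sum1_card.
apply: leq_sum => C CP; rewrite card_gt0.
by apply: contraTneq CP => ->; case/and3P: partP.
Qed.

Lemma exists_block_gt1 (P : {set {set V}}) :
  partition P [set: V] -> #|P| < #|V| -> exists2 A, A \in P & 1 < #|A|.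
Proof.
move=> partP ltPn.
have [A /andP[AP A_gt1] | noA] := pickP (fun A => (A \in P) && (1 < #|A|)).
  by exists A.
move: ltPn; rewrite ltnNge -cardsT (card_partition partP) -sum1_card.
by case/negP; apply: leq_sum => C CP; move: (noA C); rewrite CP /= ltnNge => /negbFE.
Qed.

Lemma coalition_partner (P : {set {set V}}) (B : {set V}) :
  sec_partition e P -> B \in P -> ~~ secure_dominating e B ->
  exists C, [/\ C \in P, C != B & secure_dominating e (B :|: C)].
Proof.
case/andP=> _ /forall_inP secP BP nB; case/orP: (secP B BP) => [/andP[]|].
  by rewrite (negPf nB).
by case/andP=> _ /exists_inP[C CP /andP[neCB /and4P[_ _ _ sBC]]]; exists C.
Qed.

(** With n blocks all blocks would be singletons, and the coalition that
    contains one of them would be a secure dominating set of size 2. *)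
Lemma card_sec_partition_lt (P : {set {set V}}) :
  0 < #|V| ->
  (forall S, secure_dominating e S -> 2 < #|S|) ->
  sec_partition e P -> #|P| < #|V|.
Proof.
move=> V_gt0 big secP; rewrite ltn_neqAle leq_card_sec_partition // andbT.
apply/negP=> /eqP cardP; case/andP: (secP) => partP _.
have /set0Pn[B BP] : P != set0 by rewrite -card_gt0 cardP.
have block1 C D : C \in P -> D \in P -> C != D -> #|C| + #|D| <= 2.
  move=> CP DP neCD; have := leq_two_blocks partP CP DP neCD.
  by rewrite cardP addnC leq_add2l.
have nsecB : ~~ secure_dominating e B.
  apply/negP=> secB; case/andP: (secP) => _ /forall_inP /(_ B BP).
  rewrite secB orbF => /existsP[v /andP[/eqP Bv _]].
  by move: (big B secB); rewrite Bv cards1.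
have [C [CP neCB secBC]] := coalition_partner secP BP nsecB.
have := big _ secBC; rewrite ltnNge; case/negP.
by apply: leq_trans (leq_card_setU _ _) (block1 _ _ BP CP _); rewrite eq_sym.
Qed.

Lemma SEC_lt_order :
  0 < #|V| -> (forall S, secure_dominating e S -> 2 < #|S|) ->
  SEC e < #|V|.
Proof.
move=> V_gt0 big; have [->//|/SEC_attained[P secP <-]] := posnP (SEC e).
exact: card_sec_partition_lt.
Qed.

Definition singletons (D : {set V}) : {set {set V}} := [set [set v] | v in D].

Lemma partition_singletons (D : {set V}) : partition (singletons D) D.
Proof.
apply/and3P; split.
- rewrite eqEsubset; apply/andP; split; apply/subsetP => x.
    by case/bigcupP=> _ /imsetP[v vD ->] /set1P->.
  by move=> xD; apply/bigcupP; exists [set x]; rewrite ?set11 ?imset_f.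
- apply/trivIsetP => _ _ /imsetP[v _ ->] /imsetP[w _ ->] nevw.
  rewrite disjoints1 in_set1; apply: contraNneq nevw => ->; exact: eqxx.
by apply/imsetP=> -[v _ /setP /(_ v)]; rewrite !inE eqxx.
Qed.

Lemma card_singletons (D : {set V}) : #|singletons D| = #|D|.
Proof. by rewrite card_imset //; apply: set1_inj. Qed.

Lemma SEC_discrete :
  (forall v, ~~ secure_dominating e [set v]) ->
  (forall v, exists2 w, w != v & secure_dominating e [set v; w]) ->
  #|V| <= SEC e.
Proof.
move=> nsec1 partner; rewrite -cardsT -card_singletons; apply: leq_SEC.
rewrite /sec_partition partition_singletons.
apply/forall_inP => _ /imsetP[v _ ->]; rewrite nsec1 /= .
have [w newv secvw] := partner v.
apply/orP; right; apply/exists_inP; exists [set w]; first exact: imset_f.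
rewrite (inj_eq set1_inj) newv /secure_coalition !nsec1 secvw.
by rewrite disjoints1 inE eq_sym newv.
Qed.

Lemma SEC_complete : (forall x y, e x y = (x != y)) -> #|V| <= SEC e.
Proof.
move=> adj; rewrite -cardsT -card_singletons; apply: leq_SEC.
rewrite /sec_partition partition_singletons.
have dom (D : {set V}) v : v \in D -> dominating e D.
  move=> vD; apply/forall_inP => u; rewrite inE => uD; apply/exists_inP.
  by exists v; rewrite // adj; apply: contraNneq uD => ->.
apply/forall_inP => _ /imsetP[v _ ->]; apply/orP; left; apply/andP; split.
  rewrite /secure_dominating (dom _ v) ?set11 //; apply/forall_inP => u uv.
  apply/exists_inP; exists v; rewrite ?set11 // adj.
  by rewrite (dom _ u) ?setU11 // andbT; move: uv; rewrite !inE.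
apply/existsP; exists v; rewrite eqxx /degree.
rewrite (_ : [set w | e v w] = [set~ v]) ?cardsC1 ?subn1 ?eqxx //.
by apply/setP=> w; rewrite !inE adj eq_sym.
Qed.

(** The partition consists of [A] and of the singletons outside [A], each of
    which has [A] as its coalition partner. *)
Lemma SEC_one_block (A : {set V}) :
  A != set0 -> A != setT -> ~~ secure_dominating e A ->
  (forall v, ~~ secure_dominating e [set v]) ->
  (forall v, v \notin A -> secure_dominating e (v |: A)) ->
  #|V| - #|A| < SEC e.
Proof.
move=> A0 AT nsecA nsec1 secA.
have dis v : v \notin A -> [disjoint [set v] & A] by rewrite disjoints1.
have neA v : v \notin A -> [set v] != A.
  by move=> vA; apply: contraNneq vA => <-; rewrite set11.
have part := partition_singletons (~: A).
have AnotS : A \notin singletons (~: A).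
  by apply/imsetP => -[v]; rewrite inE => /neA + AE; rewrite AE eqxx.
have <- : #|A |: singletons (~: A)| = (#|V| - #|A|).+1.
  by rewrite cardsU1 AnotS card_singletons cardsCs setCK add1n.
apply: leq_SEC; rewrite /sec_partition; apply/andP; split.
  case/and3P: part => /eqP cov triv non0; apply/and3P; split.
  - by rewrite /cover bigcup_setU big_set1 -/(cover _) cov setUCr.
  - apply/trivIsetP=> B C /setU1P BP /setU1P CP.
    case: BP CP => [->|BP] [->|CP]; first by rewrite eqxx.
    + by case/imsetP: CP => v; rewrite inE => /dis d -> _; rewrite disjoint_sym.
    + by case/imsetP: BP => v; rewrite inE => /dis d -> _.
    by move/trivIsetP: triv; apply.
  by rewrite !inE negb_or eq_sym A0.
apply/forall_inP => B /setU1P[->|/imsetP[v + ->]]; last rewrite inE => vA;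
  apply/orP; right.
  rewrite nsecA; have /subsetPn[v _ vA] : ~~ (setT \subset A) by rewrite subTset.
  apply/exists_inP; exists [set v].
    by apply/setU1P; right; apply: imset_f; rewrite inE.
  rewrite neA // /secure_coalition disjoint_sym dis // nsecA nsec1.
  by rewrite setUC secA.
rewrite nsec1; apply/exists_inP.
exists A; first exact: setU11.
by rewrite eq_sym neA // /secure_coalition dis // nsecA nsec1 secA.
Qed.

End Partitions.

(** * Secure domination in trees *)

(** Goals made of disequalities that are known up to symmetry: [uniq] of, or
    non-membership in, an explicit sequence. *)
Ltac solve_distinct :=
  rewrite /= ?inE ?negb_or ?andbT; repeat (apply/andP; split);
  first [done | assumption | rewrite eq_sym; assumption].

Section Trees.

Variables (V : finType) (e : rel V).
Hypothesis treeT : tree e.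

Let symE : symmetric e. Proof. by case: treeT => _ []. Qed.
Let irrE : irreflexive e. Proof. by case: treeT => _ []. Qed.

Lemma tree_no_cycle (c : seq V) : 2 < size c -> uniq c -> ~~ cycle e c.
Proof.
case: treeT => _ _ _ acy; rewrite ltnNge => c_gt2 uc; apply: contra c_gt2.
by move=> cyc; rewrite -ltnS; apply: acy; apply/andP.
Qed.

Lemma adj_neq x y : e x y -> x != y.
Proof. by apply: contraTneq => ->; rewrite irrE. Qed.

Lemma triangle_free x y z : e x y -> e y z -> ~~ e x z.
Proof.
move=> xy yz; apply/negP=> xz; have := @tree_no_cycle [:: x; y; z] isT.
by rewrite /= !inE negb_or !adj_neq // xy yz symE xz /= => /(_ isT).
Qed.

Lemma square_free x y p q :
  x != y -> p != q -> e x p -> e y p -> e x q -> e y q -> False.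
Proof.
move=> nexy nepq xp yp xq yq; have := @tree_no_cycle [:: x; p; y; q] isT.
rewrite /= !inE !negb_or nexy nepq !adj_neq ?(symE p) ?(symE q) //.
by rewrite xp yp yq xq /= => /(_ isT).
Qed.

Lemma edge_out (A : {set V}) x y : x \in A -> y \notin A ->
  exists a b, [/\ a \in A, b \notin A & e a b].
Proof.
move=> xA yA.
have [[a b] /= /and3P[aA bA ab]|noedge] :=
  pickP (fun p => [&& p.1 \in A, p.2 \notin A & e p.1 p.2]).
  by exists a, b.
have clA : closed e (mem A).
  move=> a b ab; apply/idP/idP => [aA|bA]; apply/negPn/negP => nA.
    by move: (noedge (a, b)); rewrite /= aA nA ab.
  by move: (noedge (b, a)); rewrite /= bA nA symE ab.
by case: treeT => _ _ /(_ x y) /(closed_connect clA); rewrite xA (negPf yA).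
Qed.

Lemma exists_notin_seq (s : seq V) : size s < #|V| -> exists y, y \notin s.
Proof.
move=> ltsn; apply/existsP; rewrite -negb_forall.
apply: contraTN ltsn => /forallP alls; rewrite -leqNgt.
apply: leq_trans (card_size s).
by apply/subset_leq_card/subsetP=> z _; apply: alls.
Qed.

Lemma edge_out_seq (s : seq V) x : x \in s -> size s < #|V| ->
  exists a b, [/\ a \in s, b \notin s & e a b].
Proof.
move=> xs /exists_notin_seq[y ys].
have [||a [b []]] := @edge_out [set z in s] x y; rewrite ?inE //.
by exists a, b.
Qed.

Lemma uniq_full (s : seq V) x : uniq s -> size s = #|V| -> x \in s.
Proof.
move=> us sn; apply/negPn/negP => xs.
have /card_uniqP : uniq (x :: s) by rewrite /= xs.
by move=> cs; have := max_card (mem (x :: s)); rewrite cs /= sn ltnn.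
Qed.

(** A chord closes the segment of the path that it spans into a cycle. *)
Lemma sorted_no_chord s x0 i j : sorted e s -> uniq s ->
  i.+1 < j -> j < size s -> ~~ e (nth x0 s i) (nth x0 s j).
Proof.
move=> ss us ltij ltjs; have ltis : i < size s := ltn_trans (ltnW ltij) ltjs.
have := drop_sorted i (take_sorted j.+1 ss).
have := drop_uniq i (take_uniq j.+1 us).
have : 2 < size (drop i (take j.+1 s)).
  by rewrite size_drop size_take_min (minn_idPl ltjs) ltn_subRL addn2.
have lastE : last x0 (drop i (take j.+1 s)) = nth x0 s j.
  rewrite (last_nth x0) size_drop size_takel //.
  rewrite subSn ?(ltnW (ltnW ltij)) //= nth_drop subnKC ?(ltnW (ltnW ltij)) //.
  by rewrite nth_take.
rewrite -lastE (drop_nth x0) ?size_takel ?(ltn_trans (ltnW ltij)) //.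
rewrite nth_take ?(ltn_trans (ltnW ltij)) //=.
set p := drop _ _ => p_gt2 up pathp.
have := @tree_no_cycle (nth x0 s i :: p) p_gt2 up.
by rewrite /= rcons_path pathp /= symE.
Qed.

(** When the guard at [v] moves to [u], a vertex [w] may in general be saved by
    [u] alone; without triangles this cannot happen, since such a [w] had a
    neighbour in [S] and [v] is not one. *)
Lemma defenderP S u : secure_dominating e S -> u \notin S ->
  exists v, [/\ v \in S, e u v &
    forall w, w \notin S -> w != u -> exists z, [/\ z \in S, z != v & e w z]].
Proof.
case/andP=> /forall_inP domS /forall_inP secS uS.
have uCS w : w \notin S -> w \in ~: S by rewrite inE.
have /exists_inP[v vS /andP[uv /forall_inP domv]] := secS u (uCS _ uS).
exists v; split=> // w wS wu.
have /domv : w \in ~: (u |: S :\ v) by rewrite !inE negb_or wu negb_and wS orbT.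
case/exists_inP=> z; rewrite !inE => /orP[/eqP->|/andP[zv zS]] wz; last first.
  by exists z.
have /exists_inP[t tS wt] := domS w (uCS _ wS); exists t; split=> //.
by apply: contraTneq wt => ->; apply: triangle_free wz uv.
Qed.

(** The only possible defender of [a] is [v], and moving it to [a] leaves [b]
    undominated. *)
Lemma private_neighbour_unique S v a b : secure_dominating e S ->
  a \notin S -> b \notin S -> a != b ->
  (forall z, z \in S -> e a z -> z = v) ->
  (forall z, z \in S -> e b z -> z = v) -> False.
Proof.
move=> secS aS bS neab priva privb.
have [t [tS at_ /(_ b bS)]] := defenderP secS aS.
case=> [|z [zS + bz]]; first by rewrite eq_sym.
by rewrite (priva t) // (privb z) // eqxx.
Qed.

(** A choice of defenders is an injection from the complement of [S] into [S]:
    two vertices with the same defender [v] are, by [defenderP], also both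
    adjacent to the other element of [S], which makes a 4-cycle. *)
Lemma secure_order_bound S : secure_dominating e S -> #|S| <= 2 ->
  #|V| <= 2 * #|S|.
Proof.
move=> secS leS2.
have [d dP] : exists d : V -> V, forall u, u \notin S ->
    [/\ d u \in S, e u (d u) &
    forall w, w \notin S -> w != u -> exists z, [/\ z \in S, z != d u & e w z]].
  apply: (fin_all_exists (P := fun u v => u \notin S -> [/\ v \in S, e u v &
    forall w, w \notin S -> w != u -> exists z, [/\ z \in S, z != v & e w z]])).
  move=> u; have [uS|/(defenderP secS)[v vP]] := boolP (u \in S).
    by exists u.
  by exists v.
rewrite -(cardsC S) mul2n -addnn leq_add2l.
rewrite -(card_in_imset (f := d)) => [|u u']; last first.
  rewrite !inE => uS u'S eqd; apply/eqP/negPn/negP => neuu'.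
  have [dS ud /(_ u' u'S)[|z [zS zd u'z]]] := dP u uS; first by rewrite eq_sym.
  have [_ u'd /(_ u uS neuu')[z' [z'S z'd uz']]] := dP u' u'S.
  have zz' : z = z'.
    apply/eqP/negPn/negP => nezz'; suff: #|d u |: [set z; z']| <= #|S|.
      rewrite cardsU1 cards2 !inE negb_or !(eq_sym (d u)) zd eqd z'd nezz'.
      by rewrite ltnNge leS2.
    by apply/subset_leq_card/subsetP => t; rewrite !inE => /or3P[]/eqP->.
  rewrite -zz' -eqd in uz' u'd.
  by apply: (square_free neuu' _ ud u'd uz' u'z); rewrite eq_sym.
by apply/subset_leq_card/subsetP => _ /imsetP[u + ->]; rewrite inE => /dP[].
Qed.

Lemma single_not_secure v : 2 < #|V| -> ~~ secure_dominating e [set v].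
Proof.
rewrite ltnNge; apply: contra => secv.
by have := secure_order_bound secv; rewrite cards1; apply.
Qed.

Lemma secure_card_gt2 S : 4 < #|V| -> secure_dominating e S -> 2 < #|S|.
Proof.
move=> n_gt4 secS; rewrite ltnNge; apply: contraTN n_gt4 => leS2.
rewrite -leqNgt; apply: leq_trans (secure_order_bound secS leS2) _.
by rewrite mul2n -(leq_double _ 2) in leS2 *.
Qed.




(** * A pair that is secured by every further vertex *)

Definition spanning_path (s : seq V) : Prop :=
  [/\ sorted e s, uniq s & forall x, x \in s].

Section PairBlock.

Variables x y : V.
Hypothesis neq_xy : x != y.
Hypothesis secureU1 : forall s, s \notin [set x; y] ->
  secure_dominating e (s |: [set x; y]).
Hypothesis order_gt4 : 4 < #|V|.

(** Since [x; y; w] dominates [u] for every [w], all remaining vertices are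
    adjacent to [u], hence pairwise non-adjacent, and each of them must be
    adjacent to [x] or to [y].  Two of them on the same side make a 4-cycle
    through [u], so there are exactly two, one on each side: the path is
    x - w - u - w' - y. *)
Lemma spanning_path_undominated u :
  u \notin [set x; y] -> ~~ e u x -> ~~ e u y ->
  exists2 s, size s = 5 & spanning_path s.
Proof.
rewrite !inE negb_or => /andP[ux uy] nux nuy.
have adju w : w \notin [:: x; y; u] -> e w u.
  rewrite !inE !negb_or => /and3P[wx wy wu].
  have [||v [+ uv _]] := @defenderP (w |: [set x; y]) u.
  - by apply: secureU1; solve_distinct.
  - by solve_distinct.
  rewrite !inE symE => /or3P[] /eqP vE; move: uv; rewrite vE //.
    by rewrite (negPf nux).
  by rewrite (negPf nuy).
have toxy w : w \notin [:: x; y; u] -> e w x || e w y.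
  move=> wn; move: (wn); rewrite !inE !negb_or => /and3P[wx wy wu].
  have [t] := @exists_notin_seq [:: x; y; u; w] order_gt4.
  rewrite !inE !negb_or => /and4P[tx ty tu tw].
  have [||v [+ wv _]] := @defenderP (t |: [set x; y]) w.
  - by apply: secureU1; solve_distinct.
  - by solve_distinct.
  rewrite !inE => /or3P[] /eqP vE; move: wv; rewrite vE => wv; rewrite ?wv ?orbT //.
  have ut : e u t by rewrite symE adju //; solve_distinct.
  by move: (triangle_free (adju _ wn) ut); rewrite wv.
have same w w' a : w \notin [:: x; y; u] -> w' \notin [:: x; y; u] ->
    w != w' -> a != u -> e w a -> e w' a -> False.
  by move=> wn w'n neww' au wa w'a; apply: (square_free neww' au) => //; apply: adju.
have build w w' : w \notin [:: x; y; u] -> w' \notin [:: x; y; u] ->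
    w != w' -> e w x -> e w' y -> exists2 s, size s = 5 & spanning_path s.
  move=> wn w'n ww' wx w'y; exists [:: x; w; u; w'; y] => //; split=> [|| z].
  - by rewrite /= (symE x) (symE u) wx w'y !adju.
  - move: wn w'n; rewrite !inE !negb_or => /and3P[? ? ?] /and3P[? ? ?].
    by solve_distinct.
  - apply/negPn/negP; rewrite !inE !negb_or => /and5P[zx zw zu zw' zy].
    have zn : z \notin [:: x; y; u] by solve_distinct.
    case/orP: (toxy z zn) => [zx'|zy'].
      by apply: (same z w x) => //; rewrite eq_sym.
    by apply: (same z w' y) => //; rewrite eq_sym.
have [w wn] : exists w, w \notin [:: x; y; u].
  by apply: exists_notin_seq; apply: ltnW.
have [w'] : exists w', w' \notin [:: w; x; y; u] by apply: exists_notin_seq.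
rewrite inE negb_or => /andP[w'w w'n].
have ww' : w != w' by rewrite eq_sym.
case/orP: (toxy w wn) (toxy w' w'n) => wa /orP[] w'a.
- by case: (same w w' x) => //; rewrite eq_sym.
- exact: (build w w').
- exact: (build w' w).
- by case: (same w w' y) => //; rewrite eq_sym.
Qed.

Hypothesis dominatedA : forall w, w \notin [set x; y] -> e w x || e w y.

(** Acyclicity makes any other neighbour of [x] or of [y] private to it, even
    with respect to [x; y; c]; so [x] and [y] have at most one such neighbour
    each, and the path is a - x - c - y - b. *)
Lemma spanning_path_common c : e c x -> e c y ->
  exists2 s, size s = 5 & spanning_path s.
Proof.
move=> cx cy; have cnx := adj_neq cx; have cny := adj_neq cy.
have private a v z : a \notin [:: x; y; c] -> v \in [set x; y] -> e a v ->
    z \in c |: [set x; y] -> e a z -> z = v.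
  rewrite !inE !negb_or => /and3P[ax ay ac] vxy av zS az.
  have cv : e c v by case/orP: vxy => /eqP->.
  apply/eqP/negPn/negP => nezv; case/or3P: zS => /eqP zE; rewrite {}zE in az nezv.
  - by move: (triangle_free az cv); rewrite av.
  - exact: (square_free ac nezv).
  - exact: (square_free ac nezv).
have unique a b v : a \notin [:: x; y; c] -> b \notin [:: x; y; c] ->
    a != b -> v \in [set x; y] -> e a v -> e b v -> False.
  move=> an bn neab vxy av bv.
  apply: (@private_neighbour_unique (c |: [set x; y]) v a b) => //.
  - by apply: secureU1; solve_distinct.
  - by move: an; rewrite !inE !negb_or => /and3P[-> -> ->].
  - by move: bn; rewrite !inE !negb_or => /and3P[-> -> ->].
  - by move=> z zS; apply: private.
  - by move=> z zS; apply: private.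
have dom w : w \notin [:: x; y; c] -> e w x || e w y.
  rewrite !inE !negb_or => /and3P[wx wy _]; apply: dominatedA.
  by solve_distinct.
have build a b : a \notin [:: x; y; c] -> b \notin [:: x; y; c] ->
    a != b -> e a x -> e b y -> exists2 s, size s = 5 & spanning_path s.
  move=> an bn ab ax by_; exists [:: a; x; c; y; b] => //; split=> [|| z].
  - by rewrite /= (symE x) (symE y) ax cx cy by_.
  - move: an bn; rewrite !inE !negb_or => /and3P[? ? ?] /and3P[? ? ?].
    by solve_distinct.
  - apply/negPn/negP; rewrite !inE !negb_or => /and5P[za zx zc zy zb].
    have zn : z \notin [:: x; y; c] by solve_distinct.
    case/orP: (dom z zn) => [zx'|zy'].
      by apply: (unique z a x) => //; rewrite !inE eqxx.
    by apply: (unique z b y) => //; rewrite !inE eqxx orbT.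
have [a an] : exists a, a \notin [:: x; y; c].
  by apply: exists_notin_seq; apply: ltnW.
have [b] : exists b, b \notin [:: a; x; y; c] by apply: exists_notin_seq.
rewrite inE negb_or => /andP[ba bn].
case/orP: (dom a an) (dom b bn) => av /orP[] bv.
- by case: (unique b a x) => //; rewrite !inE eqxx.
- by apply: (build a b) => //; rewrite eq_sym.
- exact: (build b a).
- by case: (unique b a y) => //; rewrite !inE eqxx orbT.
Qed.

(** For any other vertex [b], the set [x; y; b] is secure, so [a] and [a'] cannot
    both stay private to [x]: [b] is adjacent to one of them, and therefore to
    [y] and not to [x].  A second such vertex would close a cycle of length 4
    (same neighbour among [a] and [a']) or 6 (different ones), so the path is
    y - b - a - x - a' up to exchanging [a] and [a']. *)
Lemma spanning_path_split a a' :
  (forall w, ~~ (e w x && e w y)) ->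
  a \notin [set x; y] -> a' \notin [set x; y] -> a != a' -> e a x -> e a' x ->
  exists2 s, size s = 5 & spanning_path s.
Proof.
move=> nocommon; rewrite !inE !negb_or => /andP[ax ay] /andP[a'x a'y] neaa' eax ea'x.
have nay w : e w x -> ~~ e w y by move=> wx; have := nocommon w; rewrite wx.
have toaa' b : b \notin [:: x; y; a; a'] -> e b a || e b a'.
  rewrite !inE !negb_or => /and4P[bx by_ ba ba']; apply/negPn/negP.
  rewrite negb_or => /andP[nba nba'].
  have private w z : e w x -> ~~ e b w -> z \in b |: [set x; y] -> e w z -> z = x.
    move=> wx nbw; rewrite !inE => /or3P[] /eqP-> //; first by rewrite symE (negPf nbw).
    by rewrite (negPf (nay w wx)).
  apply: (@private_neighbour_unique (b |: [set x; y]) x a a') => //.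
  - by apply: secureU1; solve_distinct.
  - by solve_distinct.
  - by solve_distinct.
  - by move=> z; apply: private.
  - by move=> z; apply: private.
have toy b : b \notin [:: x; y; a; a'] -> e b y.
  move=> bn; have := toaa' b bn; move: bn; rewrite !inE !negb_or.
  case/and4P=> bx by_ ba ba' baa'.
  have /orP[ebx|//] : e b x || e b y by apply: dominatedA; solve_distinct.
  case/orP: baa' => [eba|eba'].
    by move: (triangle_free eba eax); rewrite ebx.
  by move: (triangle_free eba' ea'x); rewrite ebx.
have build c c' b : c \notin [set x; y] -> c' \notin [set x; y] -> c != c' ->
    e c x -> e c' x -> (forall z, z \notin [:: x; y; c; c'] -> e z y) ->
    (forall z, z \notin [:: x; y; c; c'] -> e z c || e z c') ->
    b \notin [:: x; y; c; c'] -> e b c ->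
    exists2 s, size s = 5 & spanning_path s.
  move=> cn c'n cc' cx c'x toy' tocc' bn bc.
  move: cn c'n (bn); rewrite !inE !negb_or => /andP[? ?] /andP[? ?] /and4P[? ? ? ?].
  have eyb : e y b by rewrite symE toy'.
  exists [:: y; b; c; x; c'] => //; split=> [|| z].
  - by rewrite /= (symE x) eyb bc cx c'x.
  - by solve_distinct.
  - apply/negPn/negP; rewrite !inE !negb_or => /and5P[zy zb zc zx zc'].
    have zn : z \notin [:: x; y; c; c'] by solve_distinct.
    have ezy := toy' z zn; case/orP: (tocc' z zn) => [ezc|ezc'].
      by apply: (@square_free b z c y); rewrite // 1?eq_sym 1?symE // symE.
    suff: ~~ cycle e [:: y; b; c; x; c'; z].
      by rewrite /= (symE x) (symE c' z) eyb bc cx c'x ezc' ezy.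
    by apply: tree_no_cycle => //; solve_distinct.
have [b bn] : exists b, b \notin [:: x; y; a; a'] by apply: exists_notin_seq.
have swap z : (z \in [:: x; y; a'; a]) = (z \in [:: x; y; a; a']).
  by rewrite !inE [_ || (z == a)]orbC.
have an : a \notin [set x; y] by solve_distinct.
have a'n : a' \notin [set x; y] by solve_distinct.
case/orP: (toaa' b bn) => [eba|eba']; first exact: (build a a' b).
apply: (build a' a b); rewrite ?swap //; first by rewrite eq_sym.
  by move=> z; rewrite swap => /toy.
by move=> z; rewrite swap orbC => /toaa'.
Qed.

End PairBlock.

Lemma spanning_path_pair_block x y :
  x != y -> 4 < #|V| ->
  (forall s, s \notin [set x; y] -> secure_dominating e (s |: [set x; y])) ->
  exists2 s, size s = 5 & spanning_path s.
Proof.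
move=> nexy n_gt4 secU.
have [u /and3P[uA nux nuy]|dom'] :=
  pickP (fun u => [&& u \notin [set x; y], ~~ e u x & ~~ e u y]).
  exact: (spanning_path_undominated nexy secU n_gt4 uA).
have dom w : w \notin [set x; y] -> e w x || e w y.
  by move=> wA; have := dom' w; rewrite wA -negb_or => /negbFE.
have [c /andP[cx cy]|nocommon'] := pickP (fun c => e c x && e c y).
  exact: (spanning_path_common nexy secU n_gt4 dom cx cy).
have nocommon w : ~~ (e w x && e w y) by rewrite nocommon'.
have dom_sym w : w \notin [set y; x] -> e w y || e w x.
  by rewrite setUC orbC; apply: dom.
have secU_sym s : s \notin [set y; x] -> secure_dominating e (s |: [set y; x]).
  by rewrite (setUC [set y]); apply: secU.
have nocommon_sym w : ~~ (e w y && e w x) by rewrite andbC.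
have fresh (s : seq V) : size s < 5 -> exists w, w \notin s.
  by move=> lts; apply: exists_notin_seq; apply: leq_trans n_gt4.
have [a] := fresh [:: x; y] isT; have [b] := fresh [:: x; y; a] isT.
have [c] := fresh [:: x; y; a; b] isT.
rewrite !inE !negb_or => /and4P[cx cy ca cb] /and3P[bx by_ ba] /andP[ax ay].
have an : a \notin [set x; y] by solve_distinct.
have bn : b \notin [set x; y] by solve_distinct.
have cn : c \notin [set x; y] by solve_distinct.
have an' : a \notin [set y; x] by solve_distinct.
have bn' : b \notin [set y; x] by solve_distinct.
have cn' : c \notin [set y; x] by solve_distinct.
have nexy' : y != x by rewrite eq_sym.
have splitx := spanning_path_split nexy secU n_gt4 dom nocommon.
have splity := spanning_path_split nexy' secU_sym n_gt4 dom_sym nocommon_sym.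
case/orP: (dom a an) => ea; case/orP: (dom b bn) => eb.
- exact: (splitx b a).
- by case/orP: (dom c cn) => ec; [apply: (splitx c a)|apply: (splity c b)].
- by case/orP: (dom c cn) => ec; [apply: (splitx c b)|apply: (splity c a)].
- exact: (splity b a).
Qed.

End Trees.

(** * Recognising paths and stars *)

Section Labelling.

Variables (V : finType) (s : seq V).
Hypotheses (uniq_s : uniq s) (cover_s : forall x, x \in s).

Lemma index_lt_size x : index x s < size s.
Proof. by rewrite index_mem. Qed.

Definition index_ord x : 'I_(size s) := Ordinal (index_lt_size x).

Lemma index_ord_bij : bijective index_ord.
Proof.
apply: inj_card_bij => [x y [/(congr1 (nth x s))]|].
  by rewrite !nth_index.
rewrite card_ord -(card_uniqP uniq_s); apply: max_card.
Qed.

End Labelling.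

(** Positions along the path give the isomorphism: consecutive vertices are
    adjacent by definition, other pairs by acyclicity are not. *)
Lemma spanning_path_iso (V : finType) (e : rel V) (s : seq V) :
  tree e -> spanning_path e s -> graph_iso e (path_graph (size s)).
Proof.
move=> treeT [ss us cs]; have [_ [symE irrE] _ _] := treeT.
exists (index_ord cs); first exact: index_ord_bij.
move=> x y; rewrite /path_graph /=.
wlog lexy : x y / index x s <= index y s.
  by move=> IH; case/orP: (leq_total (index x s) (index y s)) => /IH //;
    rewrite orbC symE.
rewrite [_.+1 == index x s]gtn_eqF ?ltnS // orbF.
have lty : index y s < size s by rewrite index_mem.
have [eqij|neqij] := eqVneq (index x s).+1 (index y s).
  rewrite -(nth_index x (cs x)) -(nth_index x (cs y)) -eqij.
  by rewrite (sortedP x ss) // eqij.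
symmetry; have [eqij|ltij] := eqVneq (index x s) (index y s).
  by rewrite -(nth_index x (cs x)) -(nth_index x (cs y)) eqij irrE.
apply: negbTE; rewrite -{1}(nth_index x (cs x)) -{1}(nth_index x (cs y)).
apply: (sorted_no_chord treeT) => //.
by rewrite ltn_neqAle neqij ltn_neqAle ltij lexy.
Qed.

Lemma star_iso (V : finType) (e : rel V) (c : V) (s : seq V) :
  tree e -> uniq (c :: s) -> (forall x, x \in c :: s) -> all (e c) s ->
  graph_iso e (star_graph (size s).+1).
Proof.
move=> treeT us cs /allP adjc; have [_ [symE irrE] _ _] := treeT.
exists (index_ord cs); first exact: (index_ord_bij us cs).
move=> x y; rewrite /star_graph (inj_eq (bij_inj (index_ord_bij us cs))) /=.
have inS z : c != z -> z \in s by move: (cs z); rewrite inE eq_sym => /orP[->|].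
have [<-|cx] := eqVneq c x; have [<-|cy] := eqVneq c y.
- by rewrite eqxx irrE.
- by rewrite adjc // inS.
- by rewrite eq_sym cx (symE x) adjc // inS.
- rewrite /= andbF; symmetry; apply: negbTE.
  by apply: (triangle_free treeT (y := c)); rewrite ?(symE x) adjc ?inS.
Qed.

(** * Deciding secure domination on labelled vertices *)

(** When a graph is isomorphic to one on [0, ..., k-1] given by an explicit
    relation [r], secure domination can be evaluated on the labels, with
    vertex sets replaced by predicates on [nat] and quantifiers by [all] and
    [has] over [iota 0 k].  The evaluation reduces by computation, which the
    finite sets and quantifiers themselves do not. *)
Section LabelledGraph.

Variables (V : finType) (e : rel V) (k : nat) (h : V -> 'I_k) (r : rel nat).
Hypotheses (bij_h : bijective h) (adj_h : forall x y, e x y = r (h x) (h y)).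

Lemma order_label : #|V| = k.
Proof. by rewrite (bij_eq_card bij_h) card_ord. Qed.

Lemma label_onto i : i < k -> exists x, h x = i :> nat.
Proof.
by case: bij_h => g _ gK lt_ik; exists (g (Ordinal lt_ik)); rewrite gK.
Qed.

Lemma eq_label x y : (h x == h y :> nat) = (x == y).
Proof. exact: inj_eq (inj_comp val_inj (bij_inj bij_h)) x y. Qed.

Lemma forall_label (P : pred nat) : [forall x, P (h x)] = all P (iota 0 k).
Proof.
apply/forallP/allP => [Ph i|Pi x]; last by apply: Pi; rewrite mem_iota ltn_ord.
by rewrite mem_iota /= => /label_onto[x <-].
Qed.

Lemma exists_label (P : pred nat) : [exists x, P (h x)] = has P (iota 0 k).
Proof.
apply: negb_inj; rewrite negb_exists -all_predC -forall_label.
exact: eq_forallb.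
Qed.

Definition dominating_label (D : pred nat) : bool :=
  all (fun u => ~~ D u ==> has (fun v => D v && r u v) (iota 0 k)) (iota 0 k).

Definition secure_label (D : pred nat) : bool :=
  dominating_label D &&
  all (fun u => ~~ D u ==>
    has (fun v => D v &&
      (r u v && dominating_label (fun w => (w == u) || (w != v) && D w)))
    (iota 0 k)) (iota 0 k).

Lemma dominatingE (S : {set V}) (D : pred nat) :
  (forall x, (x \in S) = D (h x)) -> dominating e S = dominating_label D.
Proof.
move=> SD; rewrite /dominating_label -forall_label.
apply: eq_forallb => u; rewrite inE SD -exists_label; congr (_ ==> _).
by apply: eq_existsb => v; rewrite SD adj_h.
Qed.

Lemma secureE (S : {set V}) (D : pred nat) :
  (forall x, (x \in S) = D (h x)) -> secure_dominating e S = secure_label D.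
Proof.
move=> SD; rewrite /secure_dominating (dominatingE SD); congr (_ && _).
rewrite -forall_label; apply: eq_forallb => u; rewrite inE SD.
rewrite -exists_label; congr (_ ==> _); apply: eq_existsb => v.
rewrite SD adj_h; congr [&& _, _ & _]; apply: dominatingE => w.
by rewrite !inE SD !eq_label.
Qed.

Definition pair_label i j : pred nat := fun w => (w == i) || (w == j).

Lemma secure_pairE p q :
  secure_dominating e [set p; q] = secure_label (pair_label (h p) (h q)).
Proof. by apply: secureE => x; rewrite !inE /pair_label !eq_label. Qed.

Lemma SEC_discrete_label :
  (forall v, ~~ secure_dominating e [set v]) ->
  all (fun i => has (fun j => (j != i) && secure_label (pair_label i j))
    (iota 0 k)) (iota 0 k) ->
  #|V| <= SEC e.
Proof.
rewrite -forall_label => nsec1 /forallP pairs; apply: SEC_discrete => // v.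
move: (pairs v); rewrite -exists_label => /existsP[w /andP[wv secvw]].
by exists w; rewrite ?secure_pairE // -eq_label.
Qed.

Lemma SEC_pair_label i j : i < k -> j < k -> i != j -> 2 < k ->
  (forall S, secure_dominating e S -> 2 < #|S|) ->
  all (fun s => pair_label i j s ||
    secure_label (fun w => (w == s) || pair_label i j w)) (iota 0 k) ->
  SEC e = #|V| - 1.
Proof.
rewrite -forall_label => ltik ltjk neij lt2k big /forallP triples.
have V_gt0 : 0 < #|V| by rewrite order_label; apply: leq_trans lt2k.
have [[p hp] [q hq]] := (label_onto ltik, label_onto ltjk).
have nepq : p != q by rewrite -eq_label hp hq.
have small (S : {set V}) : #|S| <= 2 -> ~~ secure_dominating e S.
  by rewrite leqNgt; apply/contra/big.
have cardA : #|[set p; q]| = 2 by rewrite cards2 nepq.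
apply/eqP; rewrite eqn_leq -ltnS -subSn // subSS subn0 SEC_lt_order //=.
have: #|V| - 2 < SEC e.
  rewrite -cardA; apply: SEC_one_block.
  - by rewrite -card_gt0 cardA.
  - by rewrite -subTset; apply: contraTN lt2k => /subset_leq_card;
      rewrite cardsT cardA order_label -leqNgt.
  - by apply: small; rewrite cardA.
  - by move=> v; apply: small; rewrite cards1.
  move=> v; rewrite !inE => vn; move: (triples v).
  rewrite /pair_label -hp -hq !eq_label (negPf vn) /=.
  by rewrite -(secureE (S := v |: [set p; q])) // => x; rewrite !inE !eq_label.
by rewrite -subSn ?subSS // order_label ltnW.
Qed.

End LabelledGraph.

(** * Trees on at most four vertices, and the two extremal trees *)

Definition path_rel : rel nat := fun i j => (i.+1 == j) || (j.+1 == i).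

Definition star_rel : rel nat := fun i j => (i != j) && ((i == 0) || (j == 0)).

Section SmallTrees.

Variables (V : finType) (e : rel V).
Hypothesis treeT : tree e.

Lemma SEC_path_small k : 2 < k < 5 -> graph_iso e (path_graph k) ->
  #|V| <= SEC e.
Proof.
case/andP=> k_gt2 k_lt5 [h bij_h adj_h].
have adj x y : e x y = path_rel (h x) (h y) by rewrite -adj_h.
have nsec1 v : ~~ secure_dominating e [set v].
  by apply: (single_not_secure treeT); rewrite (order_label bij_h).
apply: (SEC_discrete_label bij_h adj nsec1).
by case: k k_gt2 k_lt5 {h bij_h adj_h adj nsec1} => [|[|[|[|[|]]]]].
Qed.

Lemma SEC_path5 : graph_iso e (path_graph 5) -> SEC e = #|V| - 1.
Proof.
case=> h bij_h adj_h.
have adj x y : e x y = path_rel (h x) (h y) by rewrite -adj_h.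
(* The pair consists of the two neighbours of the middle vertex. *)
apply: (@SEC_pair_label _ _ 5 h path_rel bij_h adj 1 3) => // S.
by apply: (secure_card_gt2 treeT); rewrite (order_label bij_h).
Qed.

Lemma SEC_star4 : graph_iso e (star_graph 4) -> SEC e = #|V| - 1.
Proof.
case=> h bij_h adj_h.
have adj x y : e x y = star_rel (h x) (h y) by rewrite -adj_h /star_graph -val_eqE.
(* The pair consists of the centre and a leaf.  Here n = 4 meets the general
   bound n <= 2 #|S|, so sets of size 2 have to be excluded one by one. *)
apply: (@SEC_pair_label _ _ 4 h star_rel bij_h adj 0 1) => // S secS.
rewrite ltnNge; apply/negP=> leS2.
have := secure_order_bound treeT secS leS2; rewrite (order_label bij_h).
rewrite (leq_pmul2l (m := 2) (n1 := 2)) // => geS2.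
have /cards2P[p [q [_ SE]]] : #|S| == 2 by rewrite eqn_leq leS2.
have nopair : all (fun i => all (fun j =>
    ~~ secure_label 4 star_rel (pair_label i j)) (iota 0 4)) (iota 0 4) by [].
move: secS; rewrite SE (secure_pairE bij_h adj); apply/negP.
have mem x : nat_of_ord (h x) \in iota 0 4 by rewrite mem_iota ltn_ord.
by move/allP: nopair => /(_ _ (mem p)) /allP/(_ _ (mem q)).
Qed.

Lemma complete_of_order_le2 x y : #|V| <= 2 -> e x y = (x != y).
Proof.
have [_ [symE irrE] _ _] := treeT.
move=> le2; have [->|nexy] := eqVneq x y; first exact: irrE.
have [||a [b [/set1P-> bx xb]]] := edge_out treeT (A := [set x]) (x := x) (y := y).
- exact: set11.
- by rewrite inE eq_sym.
have -> // : y = b; apply/eqP/negPn/negP => neyb.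
have: #|x |: [set y; b]| <= #|V| by apply: max_card.
rewrite cardsU1 cards2 neyb !inE negb_or nexy.
by move: bx; rewrite inE eq_sym => ->; rewrite leqNgt ltnS le2.
Qed.

(** An edge leaving a first edge always extends it to a path on 3 vertices,
    whichever end it starts from. *)
Lemma path3_exists : 2 < #|V| ->
  exists s, [/\ size s = 3, uniq s & sorted e s].
Proof.
have [V_gt0 [symE irrE] _ _] := treeT; move=> n_gt2.
have /card_gt0P[v _] := V_gt0.
have [|a [b [av bv ab]]] := edge_out_seq treeT (mem_head v [::]).
  exact: ltnW.
have [|c [d [+ dn cd]]] := edge_out_seq treeT (mem_head a [:: b]).
  exact: n_gt2.
have neab := adj_neq treeT ab.
move: dn; rewrite !inE negb_or => /andP[da db] /orP[] /eqP cE; rewrite {c}cE in cd.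
  exists [:: b; a; d]; split; rewrite //= ?inE ?negb_or 1?symE ?ab ?cd //.
  by rewrite (eq_sym b) neab (eq_sym b) db (eq_sym a) da.
exists [:: a; b; d]; split; rewrite //= ?inE ?negb_or ?ab ?cd //.
by rewrite neab (eq_sym a) da (eq_sym b) db.
Qed.

(** The fourth vertex hangs either on the middle of a path on 3 vertices or on
    one of its ends. *)
Lemma order4_cases : #|V| = 4 ->
  graph_iso e (star_graph 4) \/ graph_iso e (path_graph 4).
Proof.
have [_ [symE irrE] _ _] := treeT; move=> n4.
have [|s [sz us]] := path3_exists; first by rewrite n4.
case: s sz us => [|a [|b [|c []]]] //= _; rewrite !inE negb_or !andbT.
case/andP=> /andP[ab ac] bc /andP[eab ebc].
have [|p [d [+ dn pd]]] := edge_out_seq treeT (mem_head a [:: b; c]).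
  by rewrite n4.
move: dn; rewrite !inE !negb_or => /and3P[da db dc].
have path4 (s : seq V) : size s = 4 -> uniq s -> sorted e s ->
    graph_iso e (path_graph 4).
  move=> sz us ss; rewrite -sz; apply: spanning_path_iso => //; split=> // x.
  by apply: uniq_full; rewrite // sz.
case/or3P=> /eqP pE; rewrite {p}pE in pd.
- right; apply: (path4 [:: d; a; b; c]); rewrite //= ?(symE d) ?pd ?eab ?ebc //.
  by solve_distinct.
- have us : uniq [:: b; a; c; d] by solve_distinct.
  left; apply: (@star_iso _ _ b [:: a; c; d] treeT us) => [x|].
    by apply: uniq_full.
  by rewrite /= symE eab ebc pd.
- right; apply: (path4 [:: a; b; c; d]); rewrite //= ?pd ?eab ?ebc //.
  by solve_distinct.
Qed.

Lemma order3_path : #|V| = 3 -> graph_iso e (path_graph 3).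
Proof.
move=> n3; have [|s [sz us ss]] := path3_exists; first by rewrite n3.
rewrite -sz; apply: spanning_path_iso => //; split=> // x.
by apply: uniq_full; rewrite // sz.
Qed.

(** Any two blocks have at most 3 elements in total and some block [A] has at
    least 2, so [A] is a pair and the others are singletons.  Two singletons are
    not in coalition, as a secure dominating set has at least 3 elements. *)
Lemma pair_block_of_SEC : 4 < #|V| -> SEC e = #|V| - 1 ->
  exists x y, x != y /\
    forall s, s \notin [set x; y] -> secure_dominating e (s |: [set x; y]).
Proof.
move=> n_gt4 SECn; have n_gt0 : 0 < #|V| by apply: leq_trans n_gt4.
have [|P secP cardP] := @SEC_attained _ e.
  by rewrite SECn subn_gt0; apply: leq_trans n_gt4.
have /andP[partP _] := secP; rewrite SECn in cardP.
have blocks A B : A \in P -> B \in P -> A != B -> #|A| + #|B| <= 3.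
  move=> AP BP neAB; have := leq_two_blocks partP AP BP neAB.
  have -> : #|V| + 2 = 3 + (#|V| - 1) by rewrite -{1}(subnK n_gt0) -addnA addnC.
  by rewrite cardP leq_add2r.
have block_gt0 B : B \in P -> 0 < #|B|.
  move=> BP; rewrite card_gt0.
  by apply: contraTneq BP => ->; case/and3P: partP.
have [|A AP A_gt1] := exists_block_gt1 partP.
  by rewrite cardP subn1 ltn_predL.
have outside s : s \notin A -> #|A| = 2 /\ secure_dominating e (s |: A).
  move=> sA; set B := pblock P s.
  have sP : s \in cover P by rewrite (cover_partition partP) inE.
  have BP : B \in P by apply: pblock_mem.
  have sB : s \in B by rewrite mem_pblock.
  have neBA : A != B by apply: contraNneq sA => ->.
  have B1 : B = [set s].
    apply/eqP; rewrite eq_sym eqEcard sub1set sB cards1 -(leq_add2l 2).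
    by apply: leq_trans (blocks A B AP BP neBA); rewrite leq_add2r.
  split.
    apply/eqP; rewrite eqn_leq A_gt1 andbT -(leq_add2r 1).
    by have := blocks A B AP BP neBA; rewrite B1 cards1.
  have nsecB : ~~ secure_dominating e B.
    by rewrite B1 single_not_secure //; do 2!apply: ltnW.
  have [C [CP neCB secBC]] := coalition_partner secP BP nsecB.
  have [<-|neCA] := eqVneq C A; first by rewrite -B1.
  have := secure_card_gt2 treeT n_gt4 secBC; rewrite ltnNge; case/negP.
  apply: leq_trans (leq_card_setU _ _) _; rewrite B1 cards1 -(leq_add2l 1) addnA.
  apply: leq_trans (blocks A C AP CP _); last by rewrite eq_sym.
  by rewrite leq_add2r.
have /subsetPn[s _ sA] : ~~ (setT \subset A).
  rewrite subTset; apply/negP=> /eqP AT.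
  have [B /andP[BP neBA]|noB] := pickP (fun B => (B \in P) && (A != B)).
    have := blocks A B AP BP neBA; rewrite AT cardsT leqNgt; case/negP.
    by apply: leq_trans (leq_addr _ _); apply: ltnW.
  have: #|P| <= 1.
    by rewrite -(cards1 A) subset_leq_card //; apply/subsetP => B BP;
      move: (noB B); rewrite BP inE eq_sym => /negbFE.
  by rewrite cardP leqNgt ltn_subRL; case/negP; do 2!apply: ltnW.
have [/eqP/cards2P[x [y [nexy AE]]] _] := outside s sA.
by exists x, y; split=> // t; rewrite -AE => /outside[].
Qed.

End SmallTrees.

Theorem corollary4p3 (V : finType) (T : rel V) (hT : tree T) :
  SEC T = #|V| - 1 <->
  graph_iso T (star_graph 4) \/ graph_iso T (path_graph 5).
Proof.
split=> [SECn|[/(SEC_star4 hT)|/(SEC_path5 hT)] //].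
have [V_gt0 _ _ _] := hT.
have SEC_lt : ~~ (#|V| <= SEC T) by rewrite SECn -ltnNge subn1 ltn_predL.
have [n_gt4|] := ltnP 4 #|V|.
  have [x [y [nexy secU]]] := pair_block_of_SEC hT n_gt4 SECn.
  have [s sz sP] := spanning_path_pair_block hT nexy n_gt4 secU.
  by right; rewrite -sz; apply: spanning_path_iso.
rewrite leq_eqVlt => /orP[/eqP /(order4_cases hT)[|/(SEC_path_small hT) leS]|].
- by left.
- by rewrite leS in SEC_lt.
rewrite ltnS leq_eqVlt => /orP[/eqP /(order3_path hT) /(SEC_path_small hT) leS|].
  by rewrite leS in SEC_lt.
rewrite ltnS => le2; case/negP: SEC_lt; apply: SEC_complete => x y.
exact: complete_of_order_le2.
Qed.
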